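(* Let $D=(E,\mathcal F)$ be a vf-safe delta-matroid, let $\sigma\in\{\ast\times,\times\ast\}$, and let $S\subseteq E$. Then there exists $A\subseteq S$, together with an ordering $e_1,\ldots,e_k$ of the elements of $A$, such that $$\omega(D^{\sigma|A})=\max_{B\subseteq S}\omega(D^{\sigma|B}),$$ and the sequence $$\omega(D),\ \omega(D^{\sigma|\{e_1\}}),\ \omega(D^{\sigma|\{e_1,e_2\}}),\ \ldots,\ \omega(D^{\sigma|A})$$ is non-decreasing.
   Context: A set system is a pair $D=(E,\mathcal F)$ with $E$ a finite set and $\mathcal F\subseteq 2^E$; the members of $\mathcal F$ are the feasible sets. $D$ is proper if $\mathcal F\neq\emptyset$. A delta-matroid is a proper set system such that for all $X,Y\in\mathcal F$ and every $u\in X\triangle Y$ there exists $v\in X\triangle Y$ (possibly $v=u$) with $X\triangle\{u,v\}\in\mathcal F$, where $\triangle$ is symmetric difference. For proper $D$, $r(D_{\max})$ and $r(D_{\min})$ denote the largest and smallest cardinality of a feasible set, and the width is $\omega(D)=r(D_{\max})-r(D_{\min})$. Twist: for $A\subseteq E$, $D^{\ast|A}=(E,\{F\triangle A\mid F\in\mathcal F\})$. Loop complementation: for $e\in E$, $D^{\times|e}=(E,\mathcal F')$ with $\mathcal F'=\mathcal F\,\triangle\,\{F\cup\{e\}\mid F\in\mathcal F,\ e\notin F\}$. Loop complementations on distinct elements commute, and for $A\subseteq E$, $D^{\times|A}$ is obtained by applying loop complementation to every element of $A$. These operations preserve properness. Words are read left to right: $D^{\ast\times|A}=(D^{\ast|A})^{\times|A}$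 and $D^{\times\ast|A}=(D^{\times|A})^{\ast|A}$; also $D^{\sigma|\emptyset}=D$. A delta-matroid $D$ is vf-safe if every set system obtained from $D$ by an arbitrary finite sequence of twists and loop complementations (on elements or subsets of $E$) is again a delta-matroid. *)

(* Defs.v *)
From mathcomp Require Import all_boot.

Set Implicit Arguments.
Unset Strict Implicit.
Unset Printing Implicit Defensive.

(* A set system (E, F) is represented by its family F : {set {set E}} of
   feasible sets; the ground set is the whole finite type E. *)

Definition symdiff (E : finType) (X Y : {set E}) : {set E} :=
  (X :\: Y) :|: (Y :\: X).

Definition proper_system (E : finType) (F : {set {set E}}) : Prop :=
  F != set0.

Definition delta_matroid (E : finType) (F : {set {set E}}) : Prop :=
  proper_system F /\
  forall X Y : {set E}, X \in F -> Y \in F ->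
  forall u : E, u \in symdiff X Y ->
  exists2 v : E, v \in symdiff X Y & symdiff X [set u; v] \in F.

Definition rmax (E : finType) (F : {set {set E}}) : nat :=
  \max_(X in F) #|X|.

(* The default value #|E| bounds every cardinality, so it only matters for
   the improper system F = set0. *)
Definition rmin (E : finType) (F : {set {set E}}) : nat :=
  \big[minn/#|E|]_(X in F) #|X|.

Definition width (E : finType) (F : {set {set E}}) : nat := rmax F - rmin F.

Definition twist (E : finType) (F : {set {set E}}) (A : {set E}) :
    {set {set E}} :=
  [set symdiff X A | X in F].

Definition loopc1 (E : finType) (F : {set {set E}}) (e : E) : {set {set E}} :=
  symdiff F [set e |: X | X in F & e \notin X].

(* The enumeration order of A is immaterial, by loopc1C below. *)
Definition loopc (E : finType) (F : {set {set E}}) (A : {set E}) :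
    {set {set E}} :=
  foldl (@loopc1 E) F (enum A).

Inductive vf_letter := Twist | LoopC.

Definition vf_op (E : finType) (o : vf_letter) (F : {set {set E}})
    (A : {set E}) : {set {set E}} :=
  match o with Twist => twist F A | LoopC => loopc F A end.

(* D^{w|A}, the word w being read from left to right. *)
Definition vf_word (E : finType) (w : seq vf_letter) (F : {set {set E}})
    (A : {set E}) : {set {set E}} :=
  foldl (fun G o => vf_op o G A) F w.

Definition vf_safe (E : finType) (F : {set {set E}}) : Prop :=
  forall ops : seq (vf_letter * {set E}),
    delta_matroid (foldl (fun G oA => vf_op oA.1 G oA.2) F ops).

Lemma in_symdiff (E : finType) (X Y : {set E}) x :
  (x \in symdiff X Y) = (x \in X) (+) (x \in Y).
Proof. by rewrite !inE; case: (x \in X); case: (x \in Y). Qed.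

Lemma in_loopc1 (E : finType) (F : {set {set E}}) e X :
  (X \in loopc1 F e) = (X \in F) (+) ((e \in X) && (X :\ e \in F)).
Proof.
rewrite in_symdiff; congr (_ (+) _); apply/imsetP/andP => [[Y]|[eX XF]].
  by rewrite inE => /andP[YF eY] ->; rewrite setU11 setU1K.
by exists (X :\ e); rewrite ?inE ?XF ?eqxx // setD1K.
Qed.

Lemma loopc1C (E : finType) (F : {set {set E}}) e f :
  loopc1 (loopc1 F e) f = loopc1 (loopc1 F f) e.
Proof.
have [-> //|ef] := eqVneq e f.
apply/setP=> X; rewrite !in_loopc1 !inE ef eq_sym ef /=.
rewrite [X :\ e :\ f]setDDl setUC -setDDl.
by case: (e \in X); case: (f \in X); case: (X \in F); case: (X :\ e \in F);
  case: (X :\ f \in F); case: (_ \in F).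
Qed.

Lemma rminP (E : finType) (F : {set {set E}}) : proper_system F ->
  exists2 X, X \in F & rmin F = #|X| /\ forall Y, Y \in F -> #|X| <= #|Y|.
Proof.
case/set0Pn=> X0 X0F; pose X := [arg min_(Z < X0 in F) #|Z|].
have [XF minX] : X \in F /\ forall Y, Y \in F -> #|X| <= #|Y|.
  by rewrite /X; case: arg_minnP.
exists X => //; split=> //; apply/eqP; rewrite eqn_leq; apply/andP; split.
  rewrite /rmin; elim: (index_enum _) (mem_index_enum X) => // Y r IHr.
  rewrite inE big_cons => /predU1P[<-|/IHr leX]; first by rewrite XF geq_minl.
  by case: ifP => // _; rewrite geq_min leX orbT.
apply: (big_ind (fun m => #|X| <= m)) => [|m n Xm Xn|Y]; last exact: minX.
  exact: max_card.
by rewrite leq_min Xm.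
Qed.

(* Main.v *)
Require Import Defs.
From mathcomp Require Import all_boot.
From mathcomp Require Import zify.

(** [width D = |E| - rmin D - rmin D'] with [D'] the full dual, loop
    complementation changes neither [rmin] nor the feasible sets of minimum
    size, and [width (D^{*×|A})] is governed by [rmin (D^{*|A})] and
    [rmin (D'^{×*|A})].  If adding a single [e] from [A] always decreases the
    width, then no minimum feasible set of [D] or of [D'] contains an element
    of [A].  Every feasible set contains a minimum one, so twisting by [A]
    cannot lower either [rmin], and the width of [D^{*×|A}] is at most that of
    [D].  Hence, unless [D] is already optimal, some element of an optimal set
    can be added without decreasing the width, and one concludes by induction.
    The word [×*] reduces to [*×] by duality. *)

Set Implicit Arguments.
Unset Strict Implicit.
Unset Printing Implicit Defensive.

Section SetSystems.
Variable E : finType.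
Implicit Types (F H : {set {set E}}) (A B S X Y Z : {set E}) (e : E).

(** * Symmetric differences and twists *)

Lemma symdiffA X Y Z : symdiff (symdiff X Y) Z = symdiff X (symdiff Y Z).
Proof. by apply/setP=> x; rewrite !in_symdiff addbA. Qed.

Lemma symdiffC X Y : symdiff X Y = symdiff Y X.
Proof. by apply/setP=> x; rewrite !in_symdiff addbC. Qed.

Lemma symdiffK A : involutive (fun X => symdiff X A).
Proof. by move=> X; apply/setP=> x; rewrite !in_symdiff -addbA addbb addbF. Qed.

Lemma symdiffT X : symdiff X setT = ~: X.
Proof. by apply/setP=> x; rewrite in_symdiff !inE addbT. Qed.

Lemma symdiffCr A : symdiff (~: A) setT = A.
Proof. by rewrite symdiffT setCK. Qed.

Lemma symdiff_disjoint A B : [disjoint A & B] -> symdiff A B = A :|: B.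
Proof.
move=> dAB; apply/setP=> x; rewrite in_symdiff inE.
by case: (boolP (x \in A)) => //= xA; rewrite (disjointFr dAB xA).
Qed.

Lemma in_twist F A X : (X \in twist F A) = (symdiff X A \in F).
Proof.
apply/imsetP/idP => [[Y YF ->]|XF]; first by rewrite symdiffK.
by exists (symdiff X A) => //; rewrite symdiffK.
Qed.

Lemma twist_twist F A B : twist (twist F A) B = twist F (symdiff A B).
Proof. by apply/setP=> X; rewrite !in_twist symdiffA (symdiffC B). Qed.

Lemma twist0 F : twist F set0 = F.
Proof.
apply/setP=> X; rewrite in_twist; suff -> : symdiff X set0 = X by [].
by apply/setP=> x; rewrite in_symdiff inE addbF.
Qed.

Lemma twistTK F : twist (twist F setT) setT = F.
Proof. by rewrite twist_twist symdiffT setCT twist0. Qed.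

Lemma twist_proper F A : proper_system F -> proper_system (twist F A).
Proof.
case/set0Pn=> X XF; apply/set0Pn; exists (symdiff X A).
by rewrite in_twist symdiffK.
Qed.

(** * Loop complementation along sets, and its commutation with twists *)

Lemma loopc1_twist F A e : e \notin A ->
  loopc1 (twist F A) e = twist (loopc1 F e) A.
Proof.
move=> eA; apply/setP=> X; rewrite in_loopc1 !in_twist in_loopc1 in_symdiff.
rewrite (negbTE eA) addbF.
suff -> : symdiff (X :\ e) A = symdiff X A :\ e by [].
apply/setP=> x; rewrite !(in_symdiff, inE).
by case: eqP => [->|] //; rewrite (negbTE eA).
Qed.

Lemma loopc_twist F A B : [disjoint A & B] ->
  loopc (twist F A) B = twist (loopc F B) A.
Proof.
move=> dAB; have: all [predC A] (enum B).
  by apply/allP=> x; rewrite mem_enum => xB; rewrite /= (disjointFl dAB xB).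
rewrite /loopc; elim: (enum B) F => //= x s IHs F /andP[xA /IHs IH].
by rewrite loopc1_twist.
Qed.

(** [enum (A :|: B)] need not be [enum A] followed by [enum B], so splitting [loopc] over a union
    requires this invariance. It suffices to swap two leading blocks. *)
Lemma foldl_loopc1_perm F (r s : seq E) :
  perm_eq r s -> foldl (@loopc1 E) F r = foldl (@loopc1 E) F s.
Proof.
move: r s; apply: catCA_perm_subst => s1 s2 s3.
have comm1 x s G : foldl (@loopc1 E) (loopc1 G x) s =
    loopc1 (foldl (@loopc1 E) G s) x.
  by elim: s G => //= y s IHs G; rewrite loopc1C IHs.
rewrite !foldl_cat; congr foldl.
elim: s1 F => //= x s1 IHs F; by rewrite -comm1 IHs.
Qed.

Lemma loopcU F A B : [disjoint A & B] ->
  loopc F (A :|: B) = loopc (loopc F A) B.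
Proof.
move=> dAB; rewrite /loopc -foldl_cat; apply: foldl_loopc1_perm.
apply: uniq_perm; rewrite ?enum_uniq // ?cat_uniq ?enum_uniq ?andbT /=.
  apply/hasPn=> x; rewrite !mem_enum => xB; by rewrite (disjointFl dAB xB).
by move=> x; rewrite mem_cat !mem_enum inE.
Qed.

Lemma loopc0 F : loopc F set0 = F.
Proof. by rewrite /loopc enum_set0. Qed.

Lemma loopc1K F e : loopc1 (loopc1 F e) e = F.
Proof.
apply/setP=> X; rewrite !in_loopc1 !inE eqxx /= addbF -addbA.
by rewrite addbb addbF.
Qed.

(** * Minimum feasible sets under loop complementation *)

Definition min_feasible F X := X \in F /\ forall Y, Y \in F -> #|X| <= #|Y|.

Lemma rmin_min F X : min_feasible F X -> rmin F = #|X|.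
Proof.
case=> XF minX; have Fp : proper_system F by apply/set0Pn; exists X.
have [Y YF [-> minY]] := rminP Fp.
by apply/eqP; rewrite eqn_leq minX // minY.
Qed.

Lemma ex_min_feasible F : proper_system F -> exists X, min_feasible F X.
Proof. by case/rminP=> X XF [_ minX]; exists X. Qed.

Lemma rmin_le F X : X \in F -> rmin F <= #|X|.
Proof.
move=> XF; have Fp : proper_system F by apply/set0Pn; exists X.
by have [Y YF [-> ]] := rminP Fp; apply.
Qed.

(** If [e] lies in [X], then [X :\ e] is too small to be feasible, so [X] is not cancelled. A newly
    feasible set contains a feasible one, so it is not smaller than [X]. *)
Lemma min_feasible_loopc1 F e X :
  min_feasible F X -> min_feasible (loopc1 F e) X.
Proof.
case=> XF minX; split=> [|Y].
  rewrite in_loopc1 XF; case: (boolP (e \in X)) => //= eX.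
  by case: (boolP (_ \in F)) => // /minX; rewrite [#|X|](cardsD1 e) eX ltnn.
rewrite in_loopc1; case: (boolP (Y \in F)) => [/minX //|_] /=.
by case/andP=> _ /minX /leq_trans; apply; rewrite subset_leq_card ?subD1set.
Qed.

Lemma min_feasible_loopc F A X :
  min_feasible (loopc F A) X <-> min_feasible F X.
Proof.
rewrite /loopc; elim: (enum A) F => //= e s IHs F; rewrite IHs.
split; last exact: min_feasible_loopc1.
by move/(min_feasible_loopc1 e); rewrite loopc1K.
Qed.

Lemma rmin_loopc F A : proper_system F -> rmin (loopc F A) = rmin F.
Proof.
case/ex_min_feasible=> X minX; rewrite (rmin_min minX).
by apply/rmin_min/min_feasible_loopc.
Qed.

Lemma loopc_proper F A : proper_system F -> proper_system (loopc F A).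
Proof.
case/ex_min_feasible=> X /(min_feasible_loopc F A)[XF _].
by apply/set0Pn; exists X.
Qed.

(** * Width through minimum sizes, and the full dual *)

Lemma rmax_twistT F : proper_system F ->
  rmax F = #|E| - rmin (twist F setT).
Proof.
move=> Fp; have [X] := ex_min_feasible (twist_proper setT Fp).
case=> [XF minX]; rewrite (rmin_min (conj XF minX)).
rewrite in_twist symdiffT in XF; have cX := cardsC X.
apply/eqP; rewrite eqn_leq; apply/andP; split.
  apply/bigmax_leqP=> Y YF; have := minX (~: Y).
  by rewrite in_twist symdiffT setCK YF => /(_ isT); have := cardsC Y; lia.
apply: leq_trans (leq_bigmax_cond (F := fun Z : {set E} => #|Z|) _ XF); lia.
Qed.

Lemma widthE F : proper_system F ->
  width F = #|E| - (rmin F + rmin (twist F setT)).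
Proof. by move=> Fp; rewrite /width rmax_twistT // -subnDA addnC. Qed.

Lemma width_twistT F : proper_system F -> width (twist F setT) = width F.
Proof.
by move=> Fp; rewrite !widthE ?twistTK 1?addnC //; apply: twist_proper.
Qed.

(** * Exchange, and minimum sizes under twists *)

Lemma min_feasible_sub F X : delta_matroid F -> X \in F ->
  exists2 Y, min_feasible F Y & Y \subset X.
Proof.
case=> Fp exch XF; have [Y0 minY0] := ex_min_feasible Fp.
(* Exchanges move a minimum set [Y] towards [X] until [Y :\: X] is empty; the bound [n] carries the
   induction. *)
have: exists n, exists2 Y, min_feasible F Y & #|Y :\: X| <= n.
  by exists #|Y0 :\: X|, Y0.
case=> n [Y]; elim: n Y => [|n IHn] Y minY.
  by rewrite leqn0 cards_eq0 setD_eq0; exists Y.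
case: (set_0Vmem (Y :\: X)) => [YX0 _|[u]].
  by exists Y; rewrite // -setD_eq0 YX0.
rewrite inE => /andP[uX uY] leYn; have [YF lowY] := minY.
have uYX : u \in symdiff Y X by rewrite in_symdiff uY (negbTE uX).
have [v vYX Y'F] := exch Y X YF XF u uYX.
(* If [v] is in [Y], possibly with [v = u], the exchange only removes elements, against
   minimality. *)
have [vY|vY] := boolP (v \in Y).
  have /proper_card : symdiff Y [set u; v] \proper Y.
    apply/properP; split; last by exists u; rewrite // in_symdiff uY !inE eqxx.
    apply/subsetP=> x; rewrite in_symdiff !inE.
    by case: eqP => [->|_] //; case: eqP => [->|_] //=; rewrite addbF.
  by rewrite ltnNge lowY.
(* Otherwise [v] comes from [X], and swapping [u] for [v] keeps the size while shrinking
   [Y :\: X]. *)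
have vX : v \in X by move: vYX; rewrite in_symdiff (negbTE vY).
have defY' : symdiff Y [set u; v] = v |: (Y :\ u).
  apply/setP=> x; rewrite in_symdiff !inE.
  case: (eqVneq x v) => [->|_] /=; first by rewrite (negbTE vY) orbT.
  by rewrite orbF; case: eqP => [->|_]; rewrite ?uY ?addbF.
have cY' : #|symdiff Y [set u; v]| = #|Y|.
  by rewrite defY' cardsU1 !inE (negbTE vY) andbF [#|Y|](cardsD1 u) uY.
apply: (IHn (symdiff Y [set u; v])); first by split; rewrite ?cY'.
rewrite -ltnS; apply: leq_trans leYn; apply: proper_card.
apply/properP; split; last by exists u; rewrite !inE uY uX ?eqxx.
apply/subsetP=> x; rewrite defY' !inE => /andP[xX]; rewrite xX /=.
by case/orP=> [/eqP xv|/andP[]//]; rewrite xv vX in xX.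
Qed.

(** If [X] is feasible after the twist, then [symdiff X A] contains a minimum set of [H]; as that
    set avoids [A], it lies in [X]. *)
Lemma rmin_twist_ge H A : delta_matroid H ->
  (forall Y, min_feasible H Y -> [disjoint Y & A]) ->
  rmin H <= rmin (twist H A).
Proof.
move=> dH disjA; have [Hp _] := dH.
have [X [XF minX]] := ex_min_feasible (twist_proper A Hp).
rewrite (rmin_min (conj XF minX)); rewrite in_twist in XF.
have [Y minY YX] := min_feasible_sub dH XF.
rewrite (rmin_min minY); apply/subset_leq_card/subsetP=> x xY.
have := subsetP YX x xY.
by rewrite in_symdiff (disjointFr (disjA Y minY) xY) addbF.
Qed.

Lemma rmin_twist1_lt H Y e :
  min_feasible H Y -> e \in Y -> rmin (twist H [set e]) < rmin H.
Proof.
move=> minY eY; rewrite (rmin_min minY) [#|Y|](cardsD1 e) eY ltnS.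
apply: rmin_le; rewrite in_twist; have [YF _] := minY.
suff -> : symdiff (Y :\ e) [set e] = Y by [].
apply/setP=> x; rewrite in_symdiff !inE.
by case: eqP => [->|_] /=; rewrite ?eY ?addbF.
Qed.

Lemma rmin_twist1_le H e :
  proper_system H -> rmin (twist H [set e]) <= (rmin H).+1.
Proof.
case/ex_min_feasible=> Y minY; have [YF _] := minY.
apply: (@leq_trans #|symdiff Y [set e]|).
  by apply: rmin_le; rewrite in_twist symdiffK.
rewrite (rmin_min minY) -add1n -(cards1 e).
apply: leq_trans (leq_card_setU [set e] Y).
apply/subset_leq_card/subsetP=> x; rewrite in_symdiff !inE.
by case: (x == e); rewrite ?addbF.
Qed.

(** * vf-safety and the word *× *)

Lemma vf_safe_delta F : vf_safe F -> delta_matroid F.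
Proof. by move/(_ [::]). Qed.

Lemma vf_safe_twist F A : vf_safe F -> vf_safe (twist F A).
Proof. by move=> sF ops; apply: (sF ((Twist, A) :: ops)). Qed.

Lemma vf_safe_loopc F A : vf_safe F -> vf_safe (loopc F A).
Proof. by move=> sF ops; apply: (sF ((LoopC, A) :: ops)). Qed.

(** Convertible to [vf_word [:: Twist; LoopC] F A]. *)
Definition twist_loopc F A := loopc (twist F A) A.

Lemma twist_loopc0 F : twist_loopc F set0 = F.
Proof. by rewrite /twist_loopc loopc0 twist0. Qed.

(** Operations on disjoint sets commute; this allows a set to be processed one element at a time. *)
Lemma twist_loopcU F A B : [disjoint A & B] ->
  twist_loopc F (A :|: B) = twist_loopc (twist_loopc F A) B.
Proof.
move=> dAB; have dBA : [disjoint B & A] by rewrite disjoint_sym.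
by rewrite /twist_loopc -loopc_twist // twist_twist symdiff_disjoint // loopcU.
Qed.

(** The inner twist by [A] splits into twists by [setT] and by [~: A]. The latter commutes with loop
    complementation on [A] and merges with the outer twist into one by [A]. *)
Lemma twist_loopcT F A :
  twist (twist_loopc F A) setT = twist (loopc (twist F setT) A) A.
Proof.
have dA : [disjoint ~: A & A] by rewrite -setI_eq0 setIC setICr.
rewrite /twist_loopc -{1}(symdiffCr A) symdiffC -twist_twist loopc_twist //.
by rewrite twist_twist symdiffCr.
Qed.

Lemma width_twist_loopc F A : proper_system F ->
  width (twist_loopc F A) =
    #|E| - (rmin (twist F A) + rmin (twist (loopc (twist F setT) A) A)).
Proof.
move=> Fp; have Ap := twist_proper A Fp.
by rewrite widthE ?twist_loopcT ?rmin_loopc //; apply: loopc_proper.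
Qed.

(** Applied in contrapositive form: if [A] improves the width, some single element of [A] does not
    lower it. *)
Lemma width_twist_loopc_le F A : vf_safe F ->
  (forall e, e \in A -> width (twist_loopc F [set e]) < width F) ->
  width (twist_loopc F A) <= width F.
Proof.
move=> sF decr; have [Fp _] := vf_safe_delta sF.
have F'p := twist_proper setT Fp.
have F'Lp B := loopc_proper B F'p.
have rmF'L B := rmin_loopc B F'p.
(* Truncation does no harm: [#|E| - a < #|E| - b] forces [b < a]. *)
have decr' e : e \in A -> rmin F + rmin (twist F setT) <
    rmin (twist F [set e]) + rmin (twist (loopc (twist F setT) [set e]) [set e]).
  by move/decr; rewrite width_twist_loopc // widthE //; lia.
(* If [e] were in a minimum set, the first summand would drop by at least one while the second grows
   by at most one, so the sum could not increase. *)
have geF : rmin F <= rmin (twist F A).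
  apply: rmin_twist_ge (vf_safe_delta sF) _ => Y minY.
  rewrite disjoint_subset; apply/subsetP=> e eY; rewrite inE; apply/negP=> eA.
  have := decr' e eA; have := rmin_twist1_lt minY eY.
  by have := rmin_twist1_le e (F'Lp [set e]); rewrite rmF'L; lia.
have geF' : rmin (twist F setT) <= rmin (twist (loopc (twist F setT) A) A).
  rewrite -(rmF'L A); apply: rmin_twist_ge.
    exact/vf_safe_delta/vf_safe_loopc/vf_safe_twist.
  move=> Y /min_feasible_loopc minY.
  rewrite disjoint_subset; apply/subsetP=> e eY; rewrite inE; apply/negP=> eA.
  (* Loop complementation on [A] and on [e] alone yield the same minimum sets, so [decr'] for the
     single element [e] applies. *)
  have minLY : min_feasible (loopc (twist F setT) [set e]) Y.
    exact/min_feasible_loopc.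
  have := decr' e eA; have := rmin_twist1_lt minLY eY.
  by have := rmin_twist1_le e Fp; rewrite rmF'L; lia.
by rewrite width_twist_loopc // widthE //; lia.
Qed.

(** Induction on [#|S|] with [F] varying: once [e] is chosen, the system becomes [twist_loopc F
    [set e]] and [S] becomes [S :\ e]. *)
Lemma twist_loopc_path F S : vf_safe F ->
  exists es : seq E,
    [/\ uniq es, {subset es <= S},
        width (twist_loopc F [set x in es])
          = \max_(B : {set E} | B \subset S) width (twist_loopc F B)
      & sorted leq [seq width (twist_loopc F [set x in take i es])
                     | i <- iota 0 (size es).+1]].
Proof.
move: {2}#|S| (erefl #|S|) => n; elim: n S F => [|n IHn] S F cS sF.
  exists [::]; split=> //; have S0 := cards0_eq cS; subst S.
  rewrite (big_pred1 set0) => [|B]; last by rewrite subset0.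
  by congr (width (twist_loopc _ _)); apply/setP=> x; rewrite !inE.
have nil0 : [set x in [::]] = set0 :> {set E} by apply/setP=> x; rewrite !inE.
have [A AS leA] : exists2 A : {set E}, A \subset S & forall B, B \subset S ->
    width (twist_loopc F B) <= width (twist_loopc F A).
  have [A AS leA] := @arg_maxnP _ set0 (fun B => B \subset S)
    (fun B => width (twist_loopc F B)) (sub0set S).
  by exists A.
have maxA : \max_(B : {set E} | B \subset S) width (twist_loopc F B)
    = width (twist_loopc F A).
  apply/eqP; rewrite eqn_leq; apply/andP; split; first exact/bigmax_leqP.
  exact: (leq_bigmax_cond (F := fun B => width (twist_loopc F B)) A AS).
have [leAF|ltFA] := leqP (width (twist_loopc F A)) (width F).
  exists [::]; split=> //; rewrite nil0 maxA; apply/eqP.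
  by rewrite eqn_leq leA ?sub0set // twist_loopc0.
have [e eA leFe] : exists2 e, e \in A & width F <= width (twist_loopc F [set e]).
  apply/exists_inP; apply: contraLR ltFA => /exists_inPn noe.
  by rewrite -leqNgt width_twist_loopc_le // => e /noe; rewrite ltnNge.
have eS := subsetP AS e eA.
have U1 B : e \notin B ->
    twist_loopc F (e |: B) = twist_loopc (twist_loopc F [set e]) B.
  by move=> eB; rewrite twist_loopcU // disjoints1.
have cS1 : #|S :\ e| = n by move: cS; rewrite (cardsD1 e) eS => -[].
have sF1 : vf_safe (twist_loopc F [set e]) by exact/vf_safe_loopc/vf_safe_twist.
have [es [es_u esS max_es mono]] := IHn _ _ cS1 sF1.
have ees : e \notin es by apply/negP=> /esS; rewrite !inE eqxx.
have cons_set (r : seq E) : [set x in e :: r] = e |: [set x in r].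
  by apply/setP=> x; rewrite !inE.
have take_cons i : twist_loopc F [set x in take i.+1 (e :: es)] =
    twist_loopc (twist_loopc F [set e]) [set x in take i es].
  rewrite /= cons_set U1 // inE; apply/negP=> /mem_take; exact/negP.
exists (e :: es); split; first by rewrite /= ees.
- by move=> x; rewrite inE => /predU1P[->//|/esS]; rewrite inE => /andP[].
(* The two maxima agree: adding [e] maps subsets of [S :\ e] to subsets of [S], and [A :\ e] attains
   the optimum because [e] is in [A]. *)
- rewrite cons_set U1 ?inE // max_es maxA; apply/eqP; rewrite eqn_leq.
  apply/andP; split.
    apply/bigmax_leqP=> B; rewrite subsetD1 => /andP[BS eB]; rewrite -U1 //.
    by apply: leA; rewrite subUset sub1set eS.
  have A1S : A :\ e \subset S :\ e by apply: setSD.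
  apply: leq_trans (leq_bigmax_cond
    (F := fun B => width (twist_loopc (twist_loopc F [set e]) B)) _ A1S).
  by rewrite -U1 ?setD1K // !inE eqxx.
(* Past its first entry [width F], the sequence is the one from the induction, which starts at
   [width (twist_loopc F [set e])]; the only new inequality is [leFe]. *)
- have -> : iota 0 (size (e :: es)).+1 = 0 :: map succn (iota 0 (size es).+1).
    by rewrite -[RHS]/(0 :: _) -(iotaDl 1).
  rewrite map_cons -map_comp (eq_map (g := fun i =>
    width (twist_loopc (twist_loopc F [set e]) [set x in take i es]))).
    move: mono; rewrite /= take0 nil0 twist_loopc0 => ->.
    by rewrite twist_loopc0 leFe.
  by move=> i; rewrite /comp take_cons.
Qed.

(** The two systems are full duals of each other by [twist_loopcT], and full duality preserves the
    width. *)
Lemma width_vf_word_loopc_twist F A : proper_system F ->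
  width (vf_word [:: LoopC; Twist] F A) = width (twist_loopc (twist F setT) A).
Proof.
move=> Fp; rewrite -[RHS]width_twistT ?twist_loopcT ?twistTK //.
exact/loopc_proper/twist_proper/twist_proper.
Qed.

End SetSystems.

Theorem theorem4p6 (E : finType) (F : {set {set E}})
    (F_delta : delta_matroid F) (F_safe : vf_safe F)
    (s : seq vf_letter)
    (s_word : s = [:: Twist; LoopC] \/ s = [:: LoopC; Twist])
    (S : {set E}) :
  exists (A : {set E}) (es : seq E),
    [/\ A \subset S,
        perm_eq es (enum A),
        width (vf_word s F A)
          = \max_(B : {set E} | B \subset S) width (vf_word s F B)
      & sorted leq
          [seq width (vf_word s F [set x in take i es])
             | i <- iota 0 (size es).+1]].
Proof.
have [Fp _] := F_delta.
(* [G] is [F] for the word *×, and the full dual of [F] for ×*. *)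
have [G sG eqG] : exists2 G, vf_safe G &
    forall A, width (vf_word s F A) = width (twist_loopc G A).
  case: s_word => ->; first by exists F.
  exists (twist F setT); first exact: vf_safe_twist.
  by move=> A; apply: width_vf_word_loopc_twist.
have [es [es_u esS max_es mono]] := twist_loopc_path S sG.
exists [set x in es], es; split.
- by apply/subsetP=> x; rewrite inE => /esS.
- by apply: uniq_perm; rewrite ?enum_uniq // => x; rewrite mem_enum inE.
- by rewrite eqG max_es; apply: eq_bigr => B _; rewrite eqG.
- by rewrite (eq_map (g := fun i => width (twist_loopc G [set x in take i es]))).
Qed.
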